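(* Let $p$ be an odd prime. Then $$g(p,0)=\begin{cases} p(p-1)^4\bigl[(p+1)^3+1\bigr] & \text{if } p-3 \text{ is a quadratic residue modulo } p,\\ p^2(p-1)^4(p^2+3p+5) & \text{otherwise.}\end{cases}$$
   Context: $\mathbb{Z}_n=\mathbb{Z}/n\mathbb{Z}$, and $GL_3(\mathbb{Z}_n)$ is the group of invertible $3\times 3$ matrices over $\mathbb{Z}_n$. For a $3\times 3$ matrix $M=[m_{ij}]$, the permanent is $\mathrm{perm}(M)=\sum_{\sigma\in S_3}\prod_{i=1}^3 m_{i\sigma(i)}$. For a positive integer $n$ and an integer $x$, $g(n,x)$ denotes the cardinality of the set $G(n,x)=\{M\in GL_3(\mathbb{Z}_n)\mid \mathrm{perm}(M)\equiv x \pmod n\}$. An integer $a$ is a quadratic residue modulo an odd prime $p$ if $p\nmid a$ and $a\equiv u^2\pmod p$ for some integer $u$ (equivalently $a^{(p-1)/2}\equiv 1\pmod p$); in particular $0$ is not counted as a quadratic residue, so $p=3$ falls in the ''otherwise'' case. *)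

(* Defs.v *)
From HB Require Import structures.
From mathcomp Require Import all_boot all_order all_fingroup all_algebra.

Set Implicit Arguments.
Unset Strict Implicit.
Unset Printing Implicit Defensive.

Import Order.TTheory GRing.Theory Num.Theory.
Local Open Scope ring_scope.

Definition permanent (R : comNzRingType) (n : nat) (M : 'M[R]_n) : R :=
  \sum_(s : 'S_n) \prod_(i < n) M i (s i).

(* 'Z_n is the ring of integers modulo n only for n > 1. *)
Definition G (n : nat) (x : int) : {set {'GL_3['Z_n]}} :=
  [set M in 'GL_3['Z_n]%g | permanent (GLval M) == x%:~R].

Definition g (n : nat) (x : int) : nat := #|G n x|.

(* 0 modulo p is not counted as a quadratic residue. *)
Definition quadratic_residue (p : nat) (a : int) : Prop :=
  ~~ (p %| a)%Z /\ exists u : int, (a = u ^+ 2 %[mod p])%Z.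

(* Main.v *)
Require Import Defs.
From mathcomp Require Import all_boot all_order all_fingroup all_algebra.
From mathcomp Require Import mxabelem ring.

(* Fix the first two rows u and v of the matrix. Its determinant and its
   permanent are then linear forms in the third row w, with coefficient vectors
   D = (u2 v3 - u3 v2, ...) and P = (u2 v3 + u3 v2, ...). Hence the number of w
   with det <> 0 and perm = 0 is q^3 - q^2 if P = 0 <> D, q^2 - q if P and D are
   independent, and 0 otherwise. In odd characteristic P and D are collinear iff
   u1 u2 v3^2 = v1 v2 u3^2 and its two cyclic analogues hold. The pairs (u, v) of
   both kinds are counted according to the zero pattern of u; when no u_i
   vanishes, collinearity says that the ratios v_i / u_i are 0, 0, 0 or of the
   form t, t w, t w^2 with w^3 = 1. The number of cube roots of unity, 3 or 1,
   is what depends on -3 being a nonzero square. *)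

Set Implicit Arguments.
Unset Strict Implicit.
Unset Printing Implicit Defensive.

Import GRing.Theory.

(** * Counting vectors orthogonal to one vector but not to another *)

Section Linear.
Local Open Scope ring_scope.
Variable F : finFieldType.

Lemma card_orthogonal m n (A : 'M[F]_(m, n)) :
  #|[set w : 'rV[F]_n | w *m A^T == 0]| = (#|F| ^ (n - \rank A))%N.
Proof.
rewrite -(mxrank_tr A) -mxrank_ker -card_rowg; apply: eq_card => w.
by rewrite inE mem_rowg; apply/eqP/sub_kermxP.
Qed.

(** The set is the orthogonal of [P] minus the common orthogonal of [P] and [D], which is the kernel
    attached to the stacked matrix. *)
Lemma card_orthogonal_diff n (P D : 'rV[F]_n) :
  #|[set w : 'rV[F]_n | (w *m D^T != 0) && (w *m P^T == 0)]| =
  (#|F| ^ (n - \rank P) - #|F| ^ (n - \rank (P + D)%MS))%N.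
Proof.
rewrite addsmxE -!card_orthogonal.
have -> : [set w : 'rV[F]_n | (w *m D^T != 0) && (w *m P^T == 0)] =
  [set w | w *m P^T == 0] :\: [set w | w *m (col_mx P D)^T == 0].
  apply/setP=> w; rewrite !inE tr_col_mx mul_mx_row row_mx_eq0 negb_and.
  by do 2!case: (_ == _).
rewrite cardsD; congr (_ - _)%N; apply: eq_card => w.
by rewrite !inE tr_col_mx mul_mx_row row_mx_eq0; do 2!case: (_ == _).
Qed.

(** Vanishing of all 2 by 2 minors. The zero vector is collinear with everything, so [P = 0] needs a
    term of its own in the count. *)
Definition collinear n (P D : 'rV[F]_n) : bool :=
  [forall i, forall j, D 0 i * P 0 j == D 0 j * P 0 i].

Lemma subrV_collinear n (P D : 'rV[F]_n) : P != 0 ->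
  (D <= P)%MS = collinear P D.
Proof.
move=> /rV0Pn[k Pk]; apply/sub_rVP/'forall_'forall_eqP => [[a ->] i j|DP].
  by rewrite !mxE; ring.
(* The factor is read off at a coordinate [k] where [P] does not vanish. *)
exists (D 0 k / P 0 k); apply/rowP => i; rewrite !mxE.
by rewrite mulrAC -DP mulfK.
Qed.

(** The cases are [P = 0], [D] a multiple of a nonzero [P], and rank 2. At most one summand is
    nonzero, since [P = 0] implies collinearity. *)
Lemma card_orthogonal_diffE (n : nat) (P D : 'rV[F]_n) : (1 < n)%N ->
  #|[set w : 'rV[F]_n | (w *m D^T != 0) && (w *m P^T == 0)]| =
  (((P == 0%R) && (D != 0%R)) * (#|F|.-1 * #|F| ^ n.-1) +
  ~~ collinear P D *
    (#|F|.-1 * #|F| ^ n.-2))%N.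
Proof.
move=> n1; rewrite card_orthogonal_diff.
have q0 : (0 < #|F|)%N by apply/card_gt0P; exists 0.
have [->|P0] := eqVneq P 0.
  rewrite adds0mx mxrank0 rank_rV subn0.
  have -> : collinear 0 D.
    by apply/'forall_'forall_eqP => i j; rewrite !mxE !mulr0.
  case: (D != 0); rewrite ?subn0 ?subnn //= mul0n mul1n addn0 subn1.
  by case: n n1 {P D} => //= n _; rewrite expnS -subn1 mulnBl mul1n.
rewrite -subrV_collinear //=.
have [DP|nDP] := boolP (D <= P)%MS.
  by rewrite (addsmx_idPl DP) subnn.
(* Two rows generate this space, and it strictly contains the line of [P]. *)
have -> : \rank (P + D)%MS = 2.
  apply/eqP; rewrite eqn_leq; apply/andP; split.
    by rewrite addsmxE rank_leq_row.
  have: (P < P + D)%MS.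
    by rewrite ltmxE addsmxSl /=; apply: contra nDP; rewrite addsmx_sub => /andP[].
  by rewrite ltmxErank rank_rV P0 => /andP[].
rewrite rank_rV P0 /=; case: n n1 {P D P0 nDP} => [|[|n]] //= _.
by rewrite mul0n mul1n subSS subn0 !subSS subn0 expnS -subn1 mulnBl mul1n.
Qed.

End Linear.

(** * Explicit 3 by 3 permanent and determinant, expanded along the last row *)

Section Perm3.
Local Open Scope ring_scope.

Local Notation i0 := (0 : 'I_3).
Local Notation i1 := (1 : 'I_3).
Local Notation i2 := (ord_max : 'I_3).

(** The images of 0 and 1 tell the six listed permutations apart, and 3! = 6 leaves no others. The
    three even ones come first. *)
Lemma perm_enum_S3 :
  perm_eq (index_enum ('S_3))
    [:: 1%g; (tperm i0 i1 * tperm i1 i2)%g; (tperm i1 i2 * tperm i0 i1)%g;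
        tperm i1 i2; tperm i0 i1; tperm i0 i2].
Proof.
set l := (X in perm_eq _ X).
have Ul : uniq l.
  apply: (@map_uniq _ _ (fun s : 'S_3 => (s i0 , s i1))).
  by rewrite /= !permM !perm1 !(tpermL, tpermR) !permE /=.
apply: uniq_perm => //; first exact: index_enum_uniq.
have sub : {subset l <= index_enum 'S_3} by move=> s _; rewrite mem_index_enum.
have sz : (size (index_enum 'S_3) <= size l)%N.
  by have := card_Sn 3; rewrite cardT enumT => ->.
by move=> s; case: (uniq_min_size Ul sub sz) => _ ->.
Qed.

Lemma sum_S3 (V : nmodType) (f : 'S_3 -> V) :
  \sum_s f s =
    f 1%g + f (tperm i0 i1 * tperm i1 i2)%g + f (tperm i1 i2 * tperm i0 i1)%g +
    f (tperm i1 i2) + f (tperm i0 i1) + f (tperm i0 i2).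
Proof.
by rewrite (perm_big _ perm_enum_S3) !big_cons big_nil /= addr0 !addrA.
Qed.

Lemma prod_ord3 (R : comNzRingType) (f : 'I_3 -> R) :
  \prod_i f i = f i0 * f i1 * f i2.
Proof.
rewrite !big_ord_recr big_ord0 /= mul1r.
by congr (f _ * f _ * _); apply: val_inj.
Qed.

Lemma permanent3 (R : comNzRingType) (M : 'M[R]_3) :
  permanent M =
    M i2 i0 * (M i0 i1 * M i1 i2 + M i0 i2 * M i1 i1) +
    M i2 i1 * (M i0 i2 * M i1 i0 + M i0 i0 * M i1 i2) +
    M i2 i2 * (M i0 i0 * M i1 i1 + M i0 i1 * M i1 i0).
Proof.
rewrite /permanent sum_S3.
rewrite !prod_ord3.
by rewrite !permM !perm1 !permE /= ?expr0 ?expr1; ring.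
Qed.

Lemma det3 (R : comNzRingType) (M : 'M[R]_3) :
  \det M =
    M i2 i0 * (M i0 i1 * M i1 i2 - M i0 i2 * M i1 i1) +
    M i2 i1 * (M i0 i2 * M i1 i0 - M i0 i0 * M i1 i2) +
    M i2 i2 * (M i0 i0 * M i1 i1 - M i0 i1 * M i1 i0).
Proof.
rewrite /determinant sum_S3.
rewrite !odd_permM !odd_tperm !odd_perm1 /=.
rewrite !prod_ord3.
by rewrite !permM !perm1 !permE /= ?expr0 ?expr1; ring.
Qed.
End Perm3.

(** * Counting pairs of rows by the zero pattern of the first one *)

Section Count.
Local Open Scope ring_scope.
Variable F : finFieldType.
Local Notation q := #|F|.

(** Collinearity of P and D for the rows (a, b, c) and (x, y, z), with a factor 2 cancelled from
    each minor. *)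
Definition dependent (a b c x y z : F) : bool :=
  [&& a * b * z ^+ 2 == x * y * c ^+ 2, b * c * x ^+ 2 == y * z * a ^+ 2 &
      c * a * y ^+ 2 == z * x * b ^+ 2].

(** The case P = 0 <> D, in coordinates. *)
Definition perm_cross_only0 (a b c x y z : F) : bool :=
  [&& b * z + c * y == 0, c * x + a * z == 0 & a * y + b * x == 0] &&
  ~~ [&& b * z - c * y == 0, c * x - a * z == 0 & a * y - b * x == 0].

Definition sum3 (f : F -> F -> F -> nat) : nat :=
  (\sum_x \sum_y \sum_z f x y z)%N.

Lemma sum3_cycle f : sum3 (fun x y z => f y z x) = sum3 f.
Proof.
rewrite /sum3 exchange_big; apply: eq_bigr => x _ /=.
by rewrite exchange_big.
Qed.

Lemma eq_sum3 f f' : (forall x y z, f x y z = f' x y z) -> sum3 f = sum3 f'.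
Proof. by move=> e; do 3![apply: eq_bigr => ? _]; rewrite e. Qed.

Lemma sum_const n : (\sum_(x : F) n = q * n)%N.
Proof. by rewrite sum_nat_const. Qed.

Lemma sum_pred1 (t : F) : (\sum_x (x == t : nat) = 1)%N.
Proof. by rewrite (bigD1 t) //= eqxx big1 ?addn0 // => i /negbTE ->. Qed.

Lemma sum_neq0 (f : F -> nat) n : (forall x, x != 0 -> f x = n) ->
  (\sum_x f x = f 0%R + q.-1 * n)%N.
Proof.
move=> h; rewrite (bigD1 0) //= (eq_bigr (fun=> n)); last by move=> x /h.
by rewrite sum_nat_const cardC1.
Qed.

(** By cyclic invariance only the number of zeros matters; there are 1, 3, 3, 1 patterns with 3, 2,
    1, 0 zeros. *)
Lemma sum3_pattern f n0 n1 n2 n3 :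
  (forall a b c, f a b c = f b c a) ->
  f 0 0 0 = n0 ->
  (forall c, c != 0 -> f 0 0 c = n1) ->
  (forall b c, b != 0 -> c != 0 -> f 0 b c = n2) ->
  (forall a b c, a != 0 -> b != 0 -> c != 0 -> f a b c = n3) ->
  sum3 f = (n0 + 3 * q.-1 * n1 + 3 * q.-1 ^ 2 * n2 + q.-1 ^ 3 * n3)%N.
Proof.
move=> cyc f0 f1 f2 f3; rewrite /sum3.
have f1' b : b != 0 -> f 0 b 0 = n1 by move=> b0; rewrite cyc cyc f1.
have f1'' a : a != 0 -> f a 0 0 = n1 by move=> a0; rewrite cyc f1.
have f2' a c : a != 0 -> c != 0 -> f a 0 c = n2.
  by move=> a0 c0; rewrite cyc f2.
have f2'' a b : a != 0 -> b != 0 -> f a b 0 = n2.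
  by move=> a0 b0; rewrite -cyc f2.
rewrite (@sum_neq0 _ (n1 + q.-1 * n2 + q.-1 * (n2 + q.-1 * n3))%N) => [|a a0].
  rewrite (@sum_neq0 _ (n1 + q.-1 * n2)%N) => [|b b0].
    by rewrite (@sum_neq0 _ n1) ?f0 // ; ring.
  by rewrite (@sum_neq0 _ n2) => [|c c0]; rewrite ?f1' ?f2.
rewrite (@sum_neq0 _ (n2 + q.-1 * n3)%N) => [|b b0].
  by rewrite (@sum_neq0 _ n2) => [|c c0]; rewrite ?f1'' ?f2'.
by rewrite (@sum_neq0 _ n3) => [|c c0]; rewrite ?f2'' ?f3.
Qed.

Lemma dependent_cycle a b c x y z :
  dependent a b c x y z = dependent b c a y z x.
Proof. by rewrite /dependent andbC -andbA. Qed.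

Lemma perm_cross_only0_cycle a b c x y z :
  perm_cross_only0 a b c x y z = perm_cross_only0 b c a y z x.
Proof. by rewrite /perm_cross_only0; congr (_ && ~~ _); rewrite andbC -andbA. Qed.

Local Notation cube_roots := #|[set w : F | w ^+ 3 == 1]|.

(** If the first row is zero, every second row qualifies. If only [c] is nonzero, the condition is
    [x * y = 0]; if only [a] is zero, it is [x = 0]. If no entry vanishes, there is the zero row
    and, for each nonzero [x], one row per cube root of unity. *)
Lemma sum_dependent :
  sum3 (fun a b c => sum3 (dependent a b c)) =
  (q ^ 3 + 3 * q.-1 * (q * (q + q.-1)) + 3 * q.-1 ^ 2 * q ^ 2 +
    q.-1 ^ 3 * (1 + q.-1 * cube_roots))%N.
Proof.
apply: sum3_pattern.
- move=> a b c; rewrite -(sum3_cycle (dependent b c a)).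
  by apply: eq_sum3 => x y z; rewrite dependent_cycle.
- rewrite (@eq_sum3 _ (fun _ _ _ => 1%N)) => [|x y z].
    by rewrite /sum3 !sum_const; ring.
  by rewrite /dependent !(mul0r, mulr0, expr0n) /= ?(mul0r, mulr0) eqxx.
- move=> c c0.
  rewrite (@eq_sum3 _ (fun x y _ => (x * y == 0)%R : nat)) => [|x y z].
    rewrite /sum3 (@sum_neq0 _ q) => [|x x0]; last first.
      rewrite (@sum_neq0 _ 0%N) => [|y y0]; rewrite sum_const.
        by rewrite mulr0 eqxx muln1 muln0 addn0.
      by rewrite mulf_eq0 (negbTE x0) (negbTE y0) muln0.
    rewrite (eq_bigr (fun=> q)) ?sum_const; last first.
      by move=> y _; rewrite mul0r eqxx sum_const muln1.
    by ring.
  rewrite /dependent !(mul0r, mulr0, expr0n) /= ?(mul0r, mulr0) eqxx !andbT.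
  by rewrite eq_sym !mulf_eq0 ?expf_eq0 (negbTE c0) ?orbF.
- move=> b c b0 c0.
  rewrite (@eq_sum3 _ (fun x _ _ => (x == 0)%R : nat)) => [|x y z].
    rewrite /sum3 (eq_bigr (fun x => (x == 0)%R * (q ^ 2)))%N; last first.
      by move=> x _; rewrite !sum_const; ring.
    by rewrite -big_distrl /= sum_pred1 mul1n.
  rewrite /dependent !(mul0r, mulr0, expr0n) /= ?(mul0r, mulr0).
  rewrite eq_sym (eq_sym 0) !mulf_eq0 ?expf_eq0 /= (negbTE b0) (negbTE c0) /= !orbF.
  by case: (x == 0); rewrite ?orbT ?andbF.
move=> a b c a0 b0 c0.
rewrite /sum3 (@sum_neq0 _ cube_roots) => [|x x0].
  (* For [x = 0] the third equation forces [y = 0], and then the first forces [z = 0]. *)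
  congr (_ + _)%N; rewrite (eq_bigr (fun y => (y == 0)%R : nat)) ?sum_pred1 //.
  move=> y _; rewrite (eq_bigr (fun z => ((y == 0) && (z == 0))%R : nat)).
    case: (y == 0); last by rewrite big1.
    by rewrite /= sum_pred1.
  move=> z _; rewrite /dependent !(mul0r, mulr0, expr0n) /= ?(mul0r, mulr0).
  rewrite !mulf_eq0 ?expf_eq0 /= (negbTE a0) (negbTE b0) (negbTE c0) /=.
  by rewrite (eq_sym 0) !mulf_eq0 ?expf_eq0 /= (negbTE a0) ?orbF; do 2!case: (_ == 0).
(* Put [x = s a] and [y = b s w]. The third equation then gives [z = w^2 c s], and the second
   becomes [w^3 = 1]. *)
have [s s0 ->] : exists2 s, s != 0 & x = s * a.
  by exists (x / a); rewrite ?divfK // mulf_neq0 ?invr_eq0.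
have injh : injective (fun w => b * s * w).
  by apply: mulfI; rewrite mulf_neq0.
rewrite (reindex_inj injh) /= -sum1dep_card [RHS]big_mkcond.
apply: eq_bigr => w _.
rewrite (eq_bigr (fun z => ((w ^+ 3 == 1) && (z == w ^+ 2 * c * s))%R : nat)).
  by case: (w ^+ 3 == 1); [rewrite /= sum_pred1|rewrite big1].
move=> z _; congr (nat_of_bool _); rewrite /dependent.
apply/and3P/andP => [[_ /eqP e2 /eqP e3]|[/eqP w3 /eqP ->]].
  have ez : z = w ^+ 2 * c * s.
    have n0 : b ^+ 2 * s * a != 0 by rewrite !mulf_eq0 !negb_or a0 b0 s0.
    by apply: (mulfI n0); apply: etrans (etrans (esym e3) _); ring.
  split; last by rewrite ez.
  have n0 : b * c * s ^+ 2 * a ^+ 2 != 0 by rewrite !mulf_eq0 !negb_or a0 b0 c0 s0.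
  rewrite ez in e2; apply/eqP/(mulfI n0).
  by apply: etrans (etrans (esym e2) _); ring.
by split; apply/eqP; ring: w3.
Qed.

(** Only first rows with exactly one zero contribute. With more zeros, P and D agree up to signs of
    entries and vanish together; with none, P = 0 forces the second row to be zero. *)
Lemma sum_perm_cross_only0 : 2%:R != 0 :> F ->
  sum3 (fun a b c => sum3 (perm_cross_only0 a b c)) = (3 * q.-1 ^ 3)%N.
Proof.
move=> two; rewrite (@sum3_pattern _ 0 0 q.-1 0) ?muln0 ?addn0 ?add0n; first by ring.
- move=> a b c; rewrite -(sum3_cycle (perm_cross_only0 b c a)).
  by apply: eq_sum3 => x y z; rewrite perm_cross_only0_cycle.
- rewrite (@eq_sum3 _ (fun _ _ _ => 0%N)) => [|x y z].
    by rewrite /sum3 !sum_const !muln0.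
  by rewrite /perm_cross_only0 !mul0r addr0 subr0 eqxx.
- move=> c c0; rewrite (@eq_sum3 _ (fun _ _ _ => 0%N)) => [|x y z].
    by rewrite /sum3 !sum_const !muln0.
  rewrite /perm_cross_only0 !mul0r !(subr0, sub0r, addr0, add0r) oppr_eq0 eqxx.
  by rewrite !andbT andbN.
- move=> b c b0 c0.
  rewrite (@eq_sum3 _ (fun x y z => (x == 0)%R * ((y != 0)%R * (z == - (c * y) / b)%R))%N) => [|x y z].
    rewrite /sum3 (@sum_neq0 _ 0%N) => [|x x0]; last first.
      by rewrite !big1 // => y _; rewrite big1 // => z _; rewrite (negbTE x0).
    rewrite muln0 addn0 eqxx.
    rewrite (@sum_neq0 _ 1%N) ?muln1 => [|y y0].
      by rewrite big1 // => z _; rewrite eqxx.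
    rewrite (eq_bigr (fun z => (z == - (c * y) / b)%R : nat)) ?sum_pred1 //.
    by move=> z _; rewrite y0 !mul1n.
  rewrite /perm_cross_only0 !mul0r !(subr0, sub0r, addr0, add0r) oppr_eq0 !mulf_eq0.
  rewrite (negbTE b0) (negbTE c0) /=.
  have [x0|] := eqVneq x 0; last by rewrite !andbF mul0n.
  rewrite !andbT mul1n.
  have -> : (z == - (c * y) / b) = (b * z + c * y == 0).
    by rewrite -(can_eq (mulfK b0)) divfK // addr_eq0 mulrC.
  have [e|] := eqVneq (b * z + c * y) 0; last by rewrite muln0.
  rewrite muln1 /=; congr (nat_of_bool (~~ _)).
  (* Once P = 0, the only possibly nonzero entry of D is [-2 c y], so D is nonzero exactly when [y]
     is. *)
  have -> : b * z - c * y = - (2%:R * c * y) by move/eqP: e; rewrite addr_eq0 => /eqP ->; ring.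
  by rewrite oppr_eq0 !mulf_eq0 (negbTE two) (negbTE c0).
move=> a b c a0 b0 c0; rewrite (@eq_sum3 _ (fun _ _ _ => 0%N)) => [|x y z].
  by rewrite /sum3 !sum_const !muln0.
rewrite /perm_cross_only0; case: and3P => //= -[/eqP e1 /eqP e2 /eqP e3].
have x0 : x = 0.
  have n0 : 2%:R * b * c != 0 by rewrite !mulf_neq0.
  apply: (mulfI n0); rewrite mulr0.
  (* This combination of the entries of P eliminates [y] and [z], leaving [2 b c x]. *)
  transitivity (b * (c * x + a * z) + c * (a * y + b * x) - a * (b * z + c * y)).
    by ring.
  by rewrite e1 e2 e3; ring.
rewrite x0 !mulr0 ?addr0 ?add0r in e2 e3 *.
move/eqP: e2; move/eqP: e3; rewrite !mulf_eq0 (negbTE a0) /= => /eqP -> /eqP ->.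
by rewrite !(mulr0, sub0r, oppr0, addr0, eqxx).
Qed.
End Count.

(** * Cube roots of unity and square roots of -3 *)

Section CubeRoots.
Local Open Scope ring_scope.
Variable F : finFieldType.

(** The roots of [w^2 + w + 1] are [(-1 + s) / 2] and [(-1 - s) / 2]. They differ by [s], and both
    differ from 1 because [(1 - w1) * (1 - w2) = 3] is nonzero. *)
Lemma card_cube_roots_sqrt (s : F) : 2%:R != 0 :> F -> s != 0 -> s ^+ 2 = - 3%:R ->
  #|[set w : F | w ^+ 3 == 1]| = 3.
Proof.
move=> two s0 s2.
have n4 : 4%:R != 0 :> F by rewrite (natrM _ 2 2) mulf_neq0.
pose w1 := (- 1 + s) / 2%:R; pose w2 := (- 1 - s) / 2%:R.
have fac w : w ^+ 3 - 1 = (w - 1) * ((w - w1) * (w - w2)).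
  have -> : (w - w1) * (w - w2) = w ^+ 2 + w + (1 - s ^+ 2) / 4%:R.
    by rewrite /w1 /w2; field; rewrite ?n4 ?two.
  by rewrite s2; field; rewrite ?n4 ?two.
have n3 : 3%:R != 0 :> F by rewrite -oppr_eq0 -s2 expf_neq0.
have d12 : w1 != w2.
  by rewrite -subr_eq0 (_ : w1 - w2 = s) // /w1 /w2; field; rewrite ?n4 ?two.
have prod3 : (1 - w1) * (1 - w2) = 3%:R.
  have -> : (1 - w1) * (1 - w2) = (9%:R - s ^+ 2) / 4%:R.
    by rewrite /w1 /w2; field; rewrite ?n4 ?two.
  by rewrite s2; field; rewrite ?n4 ?two.
have := n3; rewrite -prod3 mulf_eq0 !subr_eq0 negb_or => /andP[d1 d2].
rewrite -(_ : #|[set 1; w1; w2]| = 3); last first.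
  by rewrite setUC cardsU1 cards2 !inE negb_or eq_sym d2 eq_sym d12 d1.
apply: eq_card => w; rewrite !inE -subr_eq0 fac !mulf_eq0 !subr_eq0.
by rewrite orbA.
Qed.

(** A root of [w^2 + w + 1] makes [2 w + 1] a square root of -3. The hypothesis still admits the
    root 0, which covers characteristic 3. *)
Lemma card_cube_roots_nosqrt : 2%:R != 0 :> F ->
  (forall s : F, s ^+ 2 = - 3%:R -> s = 0) ->
  #|[set w : F | w ^+ 3 == 1]| = 1%N.
Proof.
move=> two no; rewrite -[RHS](cards1 (1 : F)); apply: eq_card => w; rewrite !inE.
apply/idP/idP => [|/eqP ->]; last by rewrite expr1n.
have -> : (w ^+ 3 == 1) = ((w - 1) * (w ^+ 2 + w + 1) == 0).
  by rewrite -subr_eq0; congr (_ == 0); ring.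
rewrite mulf_eq0 subr_eq0 => /orP[//|/eqP e].
have e2 : (2%:R * w + 1) ^+ 2 = - 3%:R.
  transitivity (4%:R * (w ^+ 2 + w + 1) - 3%:R); first by ring.
  by rewrite e mulr0 sub0r.
have w1 := no _ e2; move: e2; rewrite w1 expr0n /= => /eqP.
rewrite eq_sym oppr_eq0 => /eqP n3.
(* Here [2 w + 1 = 0] and [3 = 0], hence [2 (w - 1) = 0]. *)
rewrite -subr_eq0; apply/eqP/(mulfI two).
transitivity (2%:R * w + 1 - 3%:R); first by ring.
by rewrite w1 n3 mulr0 subr0.
Qed.
End CubeRoots.

(** * Quadratic residues as nonzero squares of the prime field *)

Section Residue.
Local Open Scope ring_scope.

Lemma quadratic_residue_Fp p (a : int) : prime p ->
  quadratic_residue p a <-> exists2 s : 'F_p, s != 0 & s ^+ 2 = a%:~R.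
Proof.
move=> p_pr; have chF := pchar_Fp p_pr.
split=> [[pa [u /eqP]]|[s s0 sa]].
  rewrite eqz_mod_dvd (dvdz_pcharf chF) rmorphB /= subr_eq0 => /eqP e.
  exists u%:~R; last by rewrite e -rmorphXn.
  by apply: contraNneq pa => u0; rewrite (dvdz_pcharf chF) e rmorphXn /= u0 expr0n.
split; first by rewrite (dvdz_pcharf chF) -sa expf_neq0.
exists (s : nat)%:Z; apply/eqP.
rewrite eqz_mod_dvd (dvdz_pcharf chF) rmorphB /= subr_eq0 rmorphXn /=.
by rewrite -sa -pmulrn natr_Zp.
Qed.
End Residue.

(** * From pairs of rows to invertible matrices of permanent zero *)

Section Matrices.
Local Open Scope ring_scope.
Variable F : finFieldType.
Local Notation q := #|F|.
Local Notation i0 := (0 : 'I_3).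
Local Notation i1 := (1 : 'I_3).
Local Notation i2 := (ord_max : 'I_3).

Definition row3 (x y z : F) : 'rV[F]_3 := \row_i [:: x; y; z]`_i.

Lemma row3_eq0 x y z : (row3 x y z == 0) = [&& x == 0, y == 0 & z == 0].
Proof.
apply/eqP/and3P => [/rowP e|[/eqP-> /eqP-> /eqP->]].
  by split; apply/eqP; [have := e i0|have := e i1|have := e i2]; rewrite !mxE.
by apply/rowP => i; rewrite !mxE; case: i => [[|[|[]]]].
Qed.

Lemma collinear_row3 x y z x' y' z' :
  collinear (row3 x y z) (row3 x' y' z') =
  [&& x' * y == y' * x, y' * z == z' * y & z' * x == x' * z].
Proof.
apply/'forall_'forall_eqP/and3P => [e|[/eqP e1 /eqP e2 /eqP e3] i j].
  by split; apply/eqP; [have := e i0 i1|have := e i1 i2|have := e i2 i0]; rewrite !mxE.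
by rewrite !mxE; case: i j => [[|[|[|?]]] //= ?] [[|[|[|?]]] //= ?]; rewrite ?mulr0.
Qed.

(** The vector P; [cross] is D, the usual cross product. *)
Definition perm_cross (a b c x y z : F) :=
  row3 (b * z + c * y) (c * x + a * z) (a * y + b * x).
Definition cross (a b c x y z : F) :=
  row3 (b * z - c * y) (c * x - a * z) (a * y - b * x).

(** Each minor is twice the difference of the two sides of an equation in [dependent]. *)
Lemma collinear_cross a b c x y z : 2%:R != 0 :> F ->
  collinear (perm_cross a b c x y z) (cross a b c x y z) = dependent a b c x y z.
Proof.
move=> two; rewrite collinear_row3 /dependent.
have eq2 (l r l' r' : F) : l - r = 2%:R * (l' - r') -> (l == r) = (l' == r').
  by move=> e; rewrite -subr_eq0 e mulf_eq0 (negbTE two) subr_eq0.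
by congr [&& _, _ & _]; apply: eq2; ring.
Qed.

(** The first two rows are given by entries, to match the nested [sum3]; the third stays a vector,
    to be counted by linear algebra. *)
Definition rows3 (t : (F * F * F) * (F * F * F) * 'rV[F]_3) : 'M[F]_3 :=
  let: ((a, b, c), (x, y, z), w) := t in
  \matrix_i [:: row3 a b c; row3 x y z; w]`_i.

Lemma rows3_bij : bijective rows3.
Proof.
exists (fun M : 'M[F]_3 => ((M i0 i0, M i0 i1, M i0 i2),
                            (M i1 i0, M i1 i1, M i1 i2), row i2 M)).
  move=> [[[[a b] c] [[x y] z]] w]; rewrite /= !mxE /=; congr (_, _).
  by apply/rowP => j; rewrite !mxE.
move=> M; apply/matrixP => i j; rewrite !mxE /=.
case: i => [[|[|[|?]]] //= ?]; rewrite !mxE;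
  try (case: j => [[|[|[|?]]] //= ?]); by congr (M _ _); apply: val_inj.
Qed.

Lemma mul_row3_tr_eq0 (w : 'rV[F]_3) x y z :
  (w *m (row3 x y z)^T == 0) = (w 0 i0 * x + w 0 i1 * y + w 0 i2 * z == 0).
Proof.
have E : (w *m (row3 x y z)^T) 0 0 = w 0 i0 * x + w 0 i1 * y + w 0 i2 * z.
  rewrite mxE !big_ord_recr big_ord0 /= add0r !mxE /=.
  by congr (w _ _ * _ + w _ _ * _ + _); apply: val_inj.
apply/eqP/eqP => [e|e]; first by rewrite -E e mxE.
by apply/rowP => i; rewrite ord1 E e mxE.
Qed.

Lemma det_rows3 a b c x y z w :
  (\det (rows3 ((a, b, c), (x, y, z), w)) == 0) = (w *m (cross a b c x y z)^T == 0).
Proof. by rewrite mul_row3_tr_eq0 det3 !mxE. Qed.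

Lemma permanent_rows3 a b c x y z w :
  (permanent (rows3 ((a, b, c), (x, y, z), w)) == 0) =
  (w *m (perm_cross a b c x y z)^T == 0).
Proof. by rewrite mul_row3_tr_eq0 permanent3 !mxE. Qed.

Lemma sum_pair (I J : finType) (f : I * J -> nat) :
  (\sum_p f p = \sum_i \sum_j f (i, j))%N.
Proof. by rewrite (pair_bigA _ (fun i j => f (i, j))); apply: eq_bigr => -[]. Qed.

Lemma card_perm0_rows : 2%:R != 0 :> F ->
  #|[set M : 'M[F]_3 | (\det M != 0) && (permanent M == 0)]| =
  sum3 (fun a b c : F => sum3 (fun x y z : F =>
    perm_cross_only0 a b c x y z * (q.-1 * q ^ 2) +
    ~~ dependent a b c x y z * (q.-1 * q)))%N.
Proof.
move=> two.
rewrite -sum1dep_card (reindex rows3) /=; last exact/onW_bij/rows3_bij.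
rewrite big_mkcond !sum_pair.
apply: eq_bigr => a _; apply: eq_bigr => b _; apply: eq_bigr => c _.
rewrite !sum_pair.
apply: eq_bigr => x _; apply: eq_bigr => y _; apply: eq_bigr => z _.
rewrite -big_mkcond sum1dep_card.
have -> : perm_cross_only0 a b c x y z =
    (perm_cross a b c x y z == 0) && (cross a b c x y z != 0).
  by rewrite !row3_eq0.
rewrite -collinear_cross // -(@card_orthogonal_diffE F 3) //.
by apply: eq_card => w; rewrite !inE det_rows3 permanent_rows3.
Qed.

Lemma card_GL_perm0 :
  #|[set M in 'GL_3[F]%g | permanent (GLval M) == 0]| =
  #|[set M : 'M[F]_3 | (\det M != 0) && (permanent M == 0)]|.
Proof.
rewrite -(card_imset _ val_inj); apply: eq_card => M; rewrite !inE.
apply/imsetP/andP => [[A]|[M0 M1]].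
  rewrite !inE /= => A0 ->; split => //.
  rewrite -unitfE -unitmxE; exact: (GL_unitmx A).
have uM : M \is a GRing.unit by rewrite -[_ \is a _]/(M \in unitmx) unitmxE unitfE.
by exists (FinRing.unit 'M[F]_3 uM); rewrite ?inE.
Qed.

Lemma sum3_linear (f g : F -> F -> F -> nat) m n :
  (sum3 (fun x y z => f x y z * m + g x y z * n) = sum3 f * m + sum3 g * n)%N.
Proof.
rewrite /sum3 !big_distrl -big_split; apply: eq_bigr => x _ /=.
rewrite !big_distrl -big_split; apply: eq_bigr => y _ /=.
by rewrite !big_distrl -big_split.
Qed.

Lemma sum3_negb (P : F -> F -> F -> bool) :
  (sum3 (fun x y z => ~~ P x y z) + sum3 P = q ^ 3)%N.
Proof.
have := sum3_linear (fun x y z => ~~ P x y z) P 1 1; rewrite !muln1 => <-.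
rewrite (@eq_sum3 _ _ (fun _ _ _ => 1%N)) => [|x y z]; last by case: (P x y z).
by rewrite /sum3 !sum_const; ring.
Qed.

(** The count of dependent pairs is added on the left, which avoids truncated subtraction in
    [nat]. *)
Lemma card_GL3_perm0 : 2%:R != 0 :> F ->
  (#|[set M in 'GL_3[F]%g | permanent (GLval M) == 0%R]| +
    q.-1 * q * (q ^ 3 + 3 * q.-1 * (q * (q + q.-1)) + 3 * q.-1 ^ 2 * q ^ 2 +
    q.-1 ^ 3 * (1 + q.-1 * #|[set w : F | w ^+ 3 == 1%R]|)) =
  q.-1 * q * (q ^ 6 + 3 * q * q.-1 ^ 3))%N.
Proof.
move=> two; rewrite card_GL_perm0 card_perm0_rows // -sum_dependent.
pose N := sum3 (fun a b c : F => sum3 (fun x y z => ~~ dependent a b c x y z : nat)).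
have E : (N + sum3 (fun a b c : F => sum3 (dependent a b c)) = q ^ 6)%N.
  have := sum3_linear (fun a b c => sum3 (fun x y z => ~~ dependent a b c x y z : nat))
    (fun a b c => sum3 (dependent a b c)) 1 1; rewrite !muln1 => <-.
  rewrite (@eq_sum3 _ _ (fun _ _ _ => q ^ 3)%N) => [|a b c].
    by rewrite /sum3 !sum_const; ring.
  by rewrite !muln1 sum3_negb.
rewrite (eq_sum3 (fun a b c => sum3_linear _ _ _ _)) sum3_linear -/N -E.
by rewrite sum_perm_cross_only0 //; ring.
Qed.
End Matrices.

(** * Specialisation to the prime field and the closed formulas *)

Unset Implicit Arguments.
Set Strict Implicit.

Theorem theorem4 (p : nat) (p_prime : prime p) (p_odd : odd p) :
  (quadratic_residue p (p%:Z - 3)%R ->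
     g p 0%R = p * (p - 1) ^ 4 * ((p + 1) ^ 3 + 1)) /\
  (~ quadratic_residue p (p%:Z - 3)%R ->
     g p 0%R = p ^ 2 * (p - 1) ^ 4 * (p ^ 2 + 3 * p + 5)).
Proof.
have two : (2%:R != 0 :> 'F_p)%R.
  rewrite -(dvdn_pcharf (pchar_Fp p_prime)) dvdn_prime2 //.
  by apply: contraTneq p_odd => ->.
have := card_GL3_perm0 two; rewrite card_Fp //.
(* ['F_p] is by definition ['Z_(pdiv p)], and [pdiv p = p] for a prime. *)
rewrite -[#|[set M in _ | _]|]/(#|G (pdiv p) 0|) pdiv_id // -/(g p 0%R).
have c3 : ((p%:Z - 3)%:~R = - 3%:R :> 'F_p)%R.
  by rewrite rmorphB /= -!pmulrn pchar_Fp_0 // sub0r.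
have p0 := prime_gt0 p_prime.
rewrite quadratic_residue_Fp // c3 => e; split=> [[s s0 s2]|no]; move: e.
  rewrite (card_cube_roots_sqrt two s0 s2).
  (* Writing [p = m + 1] turns [p - 1] into [m]; after adding back the dependent pairs, a polynomial
     identity in [m] remains. *)
  case: p p0 {p_prime p_odd two c3 s s0 s2} => // m _ e.
  by apply: (addIn (etrans e _)); rewrite subn1 /=; ring.
rewrite (card_cube_roots_nosqrt two) => [|s s2]; last first.
  (* A nonzero square root of -3 would make [p - 3] a quadratic residue. *)
  by have [//|s0] := eqVneq s 0%R; case: no; exists s.
case: p p0 {p_prime p_odd two c3 no} => // m _ e.
by apply: (addIn (etrans e _)); rewrite subn1 /=; ring.
Qed.
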